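(* For all $k\ge 2$ and $n\ge 3$, the number of permutations $\sigma\in S_n(231)$ with $\mathrm{maxdrop}(\sigma)\le k$ and $\mathrm{des}(\sigma)=2$ equals $\frac{(n-1)^2((n-1)^2-1)}{12}$.
   Context: For a permutation $\sigma=\sigma_1\cdots\sigma_n$ of $[n]$, $\mathrm{des}(\sigma)$ is the number of $i\in[n-1]$ with $\sigma_i>\sigma_{i+1}$, and $\mathrm{maxdrop}(\sigma)=\max\{i-\sigma_i : i\in[n]\}$. $S_n(231)$ is the set of permutations of $[n]$ with no indices $a<b<c$ such that $\sigma_c<\sigma_a<\sigma_b$. *)

(* Defs.v *)
From mathcomp Require Import all_boot all_order all_fingroup all_algebra.

Set Implicit Arguments.
Unset Strict Implicit.
Unset Printing Implicit Defensive.

(* Positions and values are 0-based: a permutation sigma of {1, ..., n} is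
   encoded as s : 'S_n with s i = sigma (i + 1) - 1. Order comparisons and the
   differences i - sigma i are unaffected by this shift. *)

Definition des (n : nat) (s : 'S_n) : nat :=
  #|[set i : 'I_n | [exists j : 'I_n, (j == i.+1 :> nat) && (s j < s i)]]|.

(* The subtraction is truncated. This does not change the maximum for n > 0,
   because the position of the smallest value has i - s i >= 0; see maxdropP. *)
Definition maxdrop (n : nat) (s : 'S_n) : nat := \max_(i < n) (i - s i).

Definition avoids231 (n : nat) (s : 'S_n) : bool :=
  ~~ [exists a : 'I_n, exists b : 'I_n, exists c : 'I_n,
       [&& a < b, b < c, s c < s a & s a < s b]].

Lemma maxdropP (n : nat) (s : 'S_n) (n_gt0 : 0 < n) :
  (exists i : 'I_n, (i%:Z - (s i)%:Z = (maxdrop s)%:Z)%R) /\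
  (forall i : 'I_n, (i%:Z - (s i)%:Z <= (maxdrop s)%:Z)%R).
Proof.
have ub (i : 'I_n) : i - s i <= maxdrop s by exact: leq_bigmax.
split; last first.
  move=> i; rewrite Num.Theory.lerBlDr -PoszD lez_nat addnC.
  by rewrite -leq_subLR ub.
have [i0 maxi0] : {i0 : 'I_n | maxdrop s = i0 - s i0}.
  by apply: eq_bigmax; rewrite card_ord.
case: (leqP (s i0) i0) => [le_s | lt_s].
  by exists i0; rewrite maxi0 subzn.
have max0 : maxdrop s = 0 by rewrite maxi0; apply/eqP; rewrite subn_eq0 ltnW.
pose j := (s^-1)%g (Ordinal n_gt0).
have sj : s j = 0 :> nat by rewrite /j permKV.
by exists j; have := ub j; rewrite max0 sj subn0 leqn0 => /eqP->.
Qed.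

(* Main.v *)
(** A word [v :: w] on the alphabet [m, ..., m + n] avoids 231 iff [w] is the
    concatenation of a 231-avoiding word on the letters below [v] and one on the
    letters above [v]. Descents are additive for this decomposition, up to one
    extra descent after [v] when there are letters below it. By induction every
    drop is at most the number of descents, so for [des = 2 <= k] the condition
    on [maxdrop] is void. The same decomposition gives the quadratic recurrence
    of the Narayana polynomials, from which the coefficient of ['X^2] is read
    off. *)

Require Import Defs.
From mathcomp Require Import all_boot all_order all_fingroup all_algebra.
From mathcomp Require Import zify ring.

Set Implicit Arguments.
Unset Strict Implicit.
Unset Printing Implicit Defensive.

Import GRing.Theory.

(** * 231-avoiding words and their descents *)

Fixpoint av231 (w : seq nat) : bool :=
  if w is x :: w' then
    pairwise (fun y z => (x < y) ==> (x <= z)) w' && av231 w'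
  else true.

(** The default [x] of [head] keeps the last letter from counting as a descent. *)
Fixpoint desw (w : seq nat) : nat :=
  if w is x :: w' then (head x w' < x) + desw w' else 0.

(** The offset [m] is there for the induction: the letters above the first one form an interval that
    does not start at 0. *)
Definition avwords (m n : nat) : seq (seq nat) :=
  [seq w <- permutations (iota m n) | av231 w].

Lemma mem_avwords m n w :
  (w \in avwords m n) = av231 w && perm_eq w (iota m n).
Proof. by rewrite mem_filter mem_permutations. Qed.

Lemma avwords_uniq m n : uniq (avwords m n).
Proof. exact/filter_uniq/permutations_uniq. Qed.

Lemma mem_of_avwords m n w y :
  w \in avwords m n -> (y \in w) = (m <= y < m + n).
Proof. by rewrite mem_avwords => /andP[_ /perm_mem->]; rewrite mem_iota. Qed.

Lemma size_of_avwords m n w : w \in avwords m n -> size w = n.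
Proof. by rewrite mem_avwords => /andP[_ /perm_size]; rewrite size_iota. Qed.

Lemma pairwise_true (T : eqType) (r : rel T) s :
  {in s &, forall x y, r x y} -> pairwise r s.
Proof.
elim: s => //= x s IHs rs; apply/andP; split.
  by apply/allP => y ys; apply: rs; rewrite !inE ?eqxx ?ys ?orbT.
by apply: IHs => y z ys zs; apply: rs; rewrite inE ?ys ?zs orbT.
Qed.

(** After a letter satisfying [p] all later ones do, so the letters failing [p] form a prefix. *)
Lemma pairwise_imply_cat (T : Type) (p : pred T) s :
  pairwise (fun y z => p y ==> p z) s ->
  s = [seq y <- s | ~~ p y] ++ [seq y <- s | p y].
Proof.
elim: s => //= x s IHs /andP[xs /IHs {1}->].
case: (boolP (p x)) xs => //= px; rewrite -/(all p s) => ps.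
suff -> : [seq y <- s | ~~ p y] = [::] by [].
by elim: s ps {IHs} => //= y s IHs /andP[-> /IHs].
Qed.

(** The last letter of a 231 lies below its first, so no occurrence starts in [L] and ends in
    [R]. *)
Lemma av231_cat L R : {in L & R, forall x y, x < y} ->
  av231 (L ++ R) = av231 L && av231 R.
Proof.
elim: L => //= x L IHL LR; rewrite IHL; last first.
  by move=> y z yL zR; apply: LR; rewrite ?inE ?yL ?orbT.
have xR z : z \in R -> x <= z by move=> zR; rewrite ltnW ?LR ?mem_head.
rewrite pairwise_cat -!andbA [allrel _ _ _](_ : _ = true); last first.
  by apply/allrelP => y z _ /xR->; rewrite implybT.
rewrite [pairwise _ R](_ : _ = true) //.
by apply: pairwise_true => y z _ /xR->; rewrite implybT.
Qed.

Lemma desw_cat L R : {in L & R, forall x y, x < y} ->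
  desw (L ++ R) = desw L + desw R.
Proof.
elim: L => //= x L IHL LR; rewrite IHL; last first.
  by move=> y z yL zR; apply: LR; rewrite ?inE ?yL ?orbT.
rewrite addnA; congr (_ + _ + _); case: L LR {IHL} => //= LR.
case: R LR => //= y R LR.
by rewrite ltnn ltnNge ltnW // LR ?mem_head.
Qed.

(** * Decomposition at the first letter *)

Section Node.

Variables (m n v : nat) (L R : seq nat).
Hypotheses (le_vn : v <= n).
Hypotheses (LA : L \in avwords m v) (RA : R \in avwords (m + v).+1 (n - v)).

Let ltLR : {in L & R, forall x y, x < y}.
Proof.
by move=> x y; rewrite (mem_of_avwords _ LA) (mem_of_avwords _ RA); lia.
Qed.

(** The first letter is a descent exactly when [L] is nonempty; otherwise the next letter, if any,
    comes from [R] and is larger. *)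
Lemma desw_node : desw (m + v :: L ++ R) = (0 < v) + desw L + desw R.
Proof.
rewrite /= desw_cat // addnA; congr (_ + _ + _).
have vL := size_of_avwords LA.
case: L vL LA => [|x L'] /= vL xL.
  rewrite -vL ltnn; case: R RA => [|y R'] yR /=; first by rewrite ltnn.
  have := mem_of_avwords y yR; rewrite mem_head; lia.
by have := mem_of_avwords x xL; rewrite mem_head; lia.
Qed.

Lemma node_avwords : m + v :: L ++ R \in avwords m n.+1.
Proof.
move: (LA) (RA); rewrite !mem_avwords => /andP[avL pL] /andP[avR pR].
rewrite /= av231_cat // avL avR !andbT; apply/andP; split.
  rewrite pairwise_cat; apply/and3P; split.
  - by apply/allrelP => y z yL _; have := mem_of_avwords y LA; rewrite yL; lia.
  - apply: pairwise_true => y z yL _; have := mem_of_avwords y LA.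
    by rewrite yL; lia.
  - apply: pairwise_true => y z _ zR; have := mem_of_avwords z RA.
    by rewrite zR; lia.
rewrite -/(iota m n.+1).
have -> : iota m n.+1 = iota m v ++ (m + v) :: iota (m + v).+1 (n - v).
  by rewrite -[n.+1](_ : v + (n - v).+1 = _) ?iotaD //; lia.
rewrite perm_sym -cat1s perm_catCA /= perm_cons perm_sym.
exact: perm_cat.
Qed.

End Node.

Lemma avwords_nodeP m n w : w \in avwords m n.+1 ->
  exists v L R, [/\ v <= n, L \in avwords m v,
    R \in avwords (m + v).+1 (n - v) & w = m + v :: L ++ R].
Proof.
move=> wA; have memw y := mem_of_avwords y wA.
move: wA memw; rewrite mem_avwords => /andP[+ pw].
have : uniq w by rewrite (perm_uniq pw) iota_uniq.
case: w pw => [/perm_size|x w pw] //= /andP[xw uw] /andP[pww avw] memw.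
have := memw x; rewrite mem_head => /esym xmn.
pose L := [seq y <- w | ~~ (x < y)]; pose R := [seq y <- w | x < y].
have wLR : w = L ++ R.
  apply: (@pairwise_imply_cat _ (fun y => x < y)).
  (* Avoidance only gives [x <= z]; it becomes strict because [x] does not recur in [w]. *)
  apply: (@sub_in_pairwise _ (mem w)) pww; last exact/allP.
  move=> y z yw zw /implyP H; apply/implyP => /H; rewrite leq_eqVlt.
  by case: eqP => // xz; rewrite xz (zw : z \in w) in xw.
have LR : {in L & R, forall x y, x < y}.
  by move=> y z; rewrite !mem_filter => /andP[? _] /andP[? _]; lia.
have := avw; rewrite wLR av231_cat // => /andP[avL avR].
exists (x - m), L, R.
have memw' y : y != x -> (y \in w) = (m <= y < m + n.+1).
  by move=> yx; rewrite -memw inE (negPf yx).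
have xmx : m + (x - m) = x by lia.
rewrite xmx; split => //; first by lia.
- rewrite mem_avwords avL uniq_perm ?filter_uniq ?iota_uniq // => y.
  rewrite mem_filter mem_iota; have [->|yx] := eqVneq y x.
    by rewrite (negPf xw) andbF; lia.
  by rewrite memw' //; move: yx => /eqP; lia.
- rewrite mem_avwords avR uniq_perm ?filter_uniq ?iota_uniq // => y.
  rewrite mem_filter mem_iota; have [->|yx] := eqVneq y x.
    by rewrite (negPf xw) andbF; lia.
  by rewrite memw' //; move: yx => /eqP; lia.
Qed.

(** Letters of [L] move one position to the right, which the descent after the first letter pays
    for. In [R] positions and smallest letter both shift by [v.+1], so nothing is lost. *)
Lemma drop_le_desw m n w i : w \in avwords m n -> i < n ->
  m + i <= nth 0 w i + desw w.
Proof.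
elim/ltn_ind: n m w i => -[//|n] IHn m w i.
case/avwords_nodeP => v [L [R [le_vn LA RA ->]]].
rewrite (desw_node le_vn LA RA); case: i => [|i] /=; first lia.
rewrite ltnS => lt_in; rewrite nth_cat (size_of_avwords LA).
have [lt_iv|le_vi] := ltnP i v.
  by have := IHn v le_vn m L i LA lt_iv; lia.
have := IHn (n - v) _ _ R (i - v) RA; lia.
Qed.

(** * Narayana polynomials and their low coefficients *)

Definition narayana (m n : nat) : {poly rat} :=
  (\sum_(w <- avwords m n) 'X^(desw w))%R.

(** The decomposition is unique: the first letter gives [v], and [L] has size [v], which fixes the
    cut between [L] and [R]. *)
Lemma avwords_perm m n :
  perm_eq (avwords m n.+1)
    [seq m + v :: p.1 ++ p.2 | v <- iota 0 n.+1,
       p <- [seq (L, R) | L <- avwords m v, R <- avwords (m + v).+1 (n - v)]].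
Proof.
apply: uniq_perm; first exact: avwords_uniq.
  apply: allpairs_uniq_dep => [|v _|]; first exact: iota_uniq.
    apply: allpairs_uniq; [exact: avwords_uniq|exact: avwords_uniq|].
    by move=> [? ?] [? ?] _ _ [-> ->].
  move=> [v [L R]] [v' [L' R']] /allpairsPdep[v1 [p1 [_ Lp Ep1]]].
  move=> /allpairsPdep[v2 [p2 [_ Lp' Ep2]]] /=.
  case: Ep1 Ep2 Lp Lp' => <- <- [<- <-].
  move=> /allpairsP[[L1 R1] /= [LA _ [-> _]]].
  move=> /allpairsP[[L2 R2] /= [LA' _ [-> _]]] [/addnI vv' /eqP].
  rewrite -vv' in LA' *.
  rewrite eqseq_cat; last by rewrite (size_of_avwords LA) (size_of_avwords LA').
  by case/andP => /eqP-> /eqP->.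
move=> w; apply/idP/allpairsPdep.
  case/avwords_nodeP => v [L [R [le_vn LA RA ->]]].
  exists v, (L, R); split=> //; first by rewrite mem_iota; lia.
  exact: allpairs_f.
case=> v [p [vn /allpairsP[[L R] /= [LA RA ->]] ->]].
by apply: node_avwords => //; rewrite mem_iota in vn; lia.
Qed.

Local Open Scope ring_scope.

Lemma narayana0 m : narayana m 0 = 1.
Proof. by rewrite /narayana /avwords /= big_seq1. Qed.

Lemma narayanaS m n : narayana m n.+1 =
  narayana m.+1 n +
  'X * \sum_(v < n) narayana m v.+1 * narayana (m + v).+2 (n - v.+1).
Proof.
transitivity (\sum_(v < n.+1) 'X^(0 < v)%N *
                (narayana m v * narayana (m + v).+1 (n - v))).
  rewrite {1}/narayana (perm_big _ (avwords_perm m n)) big_allpairs_dep.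
  rewrite -(big_mkord xpredT (fun v => 'X^(0 < v)%N *
    (narayana m v * narayana (m + v).+1 (n - v)))) /index_iota subn0.
  rewrite big_seq [RHS]big_seq; apply: eq_bigr => v.
  rewrite mem_iota add0n ltnS => /andP[_ le_vn].
  rewrite big_allpairs mulr_suml mulr_sumr.
  rewrite big_seq [RHS]big_seq; apply: eq_bigr => L LA.
  rewrite mulr_sumr mulr_sumr big_seq [RHS]big_seq; apply: eq_bigr => R RA.
  by rewrite (desw_node le_vn LA RA) !exprD mulrA.
(* The term [v = 0] is split off, being the only one without the factor ['X]. *)
rewrite big_ord_recl /= expr0 mul1r narayana0 mul1r addn0 subn0 mulr_sumr.
congr (_ + _); apply: eq_bigr => v _.
by rewrite /bump /= add1n expr1 addnS.
Qed.

Lemma narayana_coef0 m n : (narayana m n)`_0 = 1.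
Proof.
elim: n m => [|n IHn] m; first by rewrite narayana0 coef1.
by rewrite narayanaS coefD coefXM IHn addr0.
Qed.

Lemma narayana_coef1 m n : (narayana m n)`_1 = n%:R * (n%:R - 1) / 2.
Proof.
elim: n m => [|n IHn] m; first by rewrite narayana0 coef1 mul0r.
rewrite narayanaS coefD coefXM IHn coef_sum.
(* All constant terms are 1, so the [n] products add [n] to the coefficient. *)
rewrite (eq_bigr (fun=> 1)) => [|v _]; last first.
  by rewrite coefM big_ord1 !narayana_coef0 mulr1.
by rewrite sumr_const card_ord -natr1; field.
Qed.

(** Hockey-stick identity: the binomials [v] choose 2 add up to [n] choose 3. *)
Lemma sum_narayana_coef1 n : \sum_(v < n) (narayana 0 v)`_1 =
  n%:R * (n%:R - 1) * (n%:R - 2) / 6 :> rat.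
Proof.
elim: n => [|n IHn]; first by rewrite big_ord0 !mul0r.
by rewrite big_ord_recr IHn /= narayana_coef1 -natr1; field.
Qed.

Lemma narayana_coef2 m n :
  (narayana m n)`_2 = n%:R * (n%:R - 1) ^+ 2 * (n%:R - 2) / 12.
Proof.
elim: n m => [|n IHn] m; first by rewrite narayana0 coef1 !mul0r.
have c1 a b := narayana_coef1 a b.
rewrite narayanaS coefD coefXM IHn coef_sum /=.
(* With constant terms 1, the linear coefficient of a product is the sum of those of its factors.
   These do not depend on the offset, so it is reset to 0. *)
rewrite (eq_bigr (fun v : 'I_n =>
  (narayana 0 v.+1)`_1 + (narayana 0 (rev_ord v))`_1)); last first.
  move=> v _; rewrite coefM big_ord_recl big_ord1 /= !narayana_coef0 mul1r mulr1.
  by rewrite addrC !c1.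
rewrite big_split /=.
rewrite -(reindex_inj rev_ord_inj (P := predT)
  (F := fun v : 'I_n => (narayana 0 v)`_1)) /=.
(* The sum over [v.+1] is the sum up to [n.+1] without its first term, which vanishes. *)
have := sum_narayana_coef1 n.+1.
rewrite big_ord_recl /= narayana0 coef1 add0r /bump => ->.
by rewrite sum_narayana_coef1 -natr1; field.
Qed.

Local Close Scope ring_scope.

(** * Transfer from permutations to words *)

Definition word (n : nat) (s : 'S_n) : seq nat :=
  [seq val (s i) | i <- enum 'I_n].

Section Word.

Variables (n : nat) (s : 'S_n).

Lemma size_word : size (word s) = n.
Proof. by rewrite size_map size_enum_ord. Qed.

Lemma nth_word (i : 'I_n) : nth 0 (word s) i = s i.
Proof. by rewrite (nth_map i) ?size_enum_ord // nth_ord_enum. Qed.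

Lemma word_perm : perm_eq (word s) (iota 0 n).
Proof.
have us : uniq (word s).
  by rewrite map_inj_uniq ?enum_uniq // => i j /val_inj/perm_inj.
apply: (uniq_perm us (iota_uniq _ _)).
suff ss : {subset word s <= iota 0 n}.
  by apply: (uniq_min_size us ss _).2; rewrite size_word size_iota.
by move=> _ /mapP[i _ ->]; rewrite mem_iota /=.
Qed.

End Word.

Lemma word_inj n : injective (@word n).
Proof.
by move=> s t st; apply/permP => i; apply: val_inj; rewrite /= -!nth_word st.
Qed.

(** Both sides are duplicate-free with [n!] entries, so one inclusion suffices. *)
Lemma words_perm n :
  perm_eq [seq word s | s : 'S_n] (permutations (iota 0 n)).
Proof.
have uw : uniq [seq word s | s : 'S_n].
  by rewrite map_inj_uniq ?enum_uniq //; exact: word_inj.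
apply: (uniq_perm uw (permutations_uniq _)).
have sw : {subset [seq word s | s : 'S_n] <= permutations (iota 0 n)}.
  by move=> _ /imageP[s _ ->]; rewrite mem_permutations word_perm.
apply: (uniq_min_size uw sw _).2.
rewrite size_permutations ?iota_uniq // size_image size_iota.
by rewrite -card_Sn.
Qed.

(** Triples with [a = 0] are the pairwise condition at the head; the others shift down to the
    tail. *)
Lemma av231P w : reflect
  (forall a b c, a < b -> b < c -> c < size w ->
     nth 0 w a < nth 0 w b -> nth 0 w a <= nth 0 w c) (av231 w).
Proof.
elim: w => [|x w IHw] /=; first by apply: ReflectT.
apply: (iffP andP) => [[/(pairwiseP 0) xw /IHw {}IHw]|H].
  case=> [|a] [|b] [|c] //; rewrite !ltnS; last exact: IHw.
  move=> _ lt_bc lt_cw xb; apply: (implyP (xw b c _ _ lt_bc)) => //.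
  by rewrite inE (ltn_trans lt_bc).
split; last by apply/IHw => a b c ab bc cw; apply: (H a.+1 b.+1 c.+1).
apply/(pairwiseP 0) => b c _ cw bc; apply/implyP.
exact: (H 0 b.+1 c.+1).
Qed.

Lemma avoids231_word n (s : 'S_n) : avoids231 s = av231 (word s).
Proof.
apply/idP/av231P => [|H].
  rewrite size_word => + a b c ab bc cn.
  have bn := ltn_trans bc cn; have an := ltn_trans ab bn.
  rewrite !(nth_word s (Ordinal an), nth_word s (Ordinal bn),
    nth_word s (Ordinal cn)).
  move=> /existsPn/(_ (Ordinal an))/existsPn/(_ (Ordinal bn)).
  by move=> /existsPn/(_ (Ordinal cn)); rewrite /= ab bc => + sab;
    rewrite sab andbT -leqNgt.
apply/existsP => -[a /existsP[b /existsP[c /and4P[ab bc sca sab]]]].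
have := H a b c ab bc; rewrite size_word !nth_word => /(_ (ltn_ord c) sab).
by rewrite leqNgt sca.
Qed.

(** The guard excludes the last position, where [nth] would return 0 and could fake a descent. *)
Lemma desw_sum w :
  desw w = \sum_(i < size w) ((i.+1 < size w) && (nth 0 w i.+1 < nth 0 w i)).
Proof.
elim: w => [|x w IHw] /=; first by rewrite big_ord0.
rewrite big_ord_recl IHw /=; congr (_ + _).
by case: w {IHw} => //=; rewrite ltnn.
Qed.

Lemma des_word n (s : 'S_n) : des s = desw (word s).
Proof.
rewrite /des desw_sum size_word -sum1dep_card big_mkcond /=.
apply: eq_bigr => i _; rewrite nth_word; have [lt_in|le_ni] := ltnP i.+1 n.
  rewrite (nth_word s (Ordinal lt_in)) /=.
  rewrite (_ : [exists j, _] = (s (Ordinal lt_in) < s i)); first by case: ltnP.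
  apply/existsP/idP => [[j /andP[/eqP ji]]|si]; last first.
    by exists (Ordinal lt_in); rewrite /= eqxx.
  by have -> : j = Ordinal lt_in by apply: val_inj.
case: existsP => // -[j /andP[/eqP ji _]].
by have := ltn_ord j; rewrite ji ltnNge le_ni.
Qed.

Lemma maxdrop_le_des n (s : 'S_n) : avoids231 s -> maxdrop s <= des s.
Proof.
rewrite avoids231_word => av; apply/bigmax_leqP => i _.
rewrite leq_subLR des_word -nth_word; apply: (@drop_le_desw 0 n) => //.
by rewrite mem_avwords av word_perm.
Qed.

Lemma narayana_perm n :
  narayana 0 n = (\sum_(s : 'S_n | avoids231 s) 'X^(des s))%R.
Proof.
rewrite /narayana big_filter -(perm_big _ (words_perm n)) /= big_map.
rewrite big_enum_cond /=; apply: eq_big => s; first by rewrite avoids231_word.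
by rewrite des_word.
Qed.

(** * The count as a coefficient *)

Local Open Scope ring_scope.

Unset Implicit Arguments.

Theorem theorem4 (k n : nat) (hk : (2 <= k)%N) (hn : (3 <= n)%N) :
  (#|[set s : 'S_n | [&& avoids231 s, (maxdrop s <= k)%N & des s == 2%N]]|)%:R
  = ((n%:R - 1) ^+ 2 * ((n%:R - 1) ^+ 2 - 1) / 12%:R :> rat).
Proof.
transitivity (narayana 0 n)`_2; last by rewrite narayana_coef2; field.
rewrite narayana_perm coef_sum -sum1dep_card natr_sum.
(* Only permutations with two descents contribute to the coefficient, each with 1. *)
rewrite [RHS](bigID (fun s => des s == 2)) /= [X in _ + X]big1 ?addr0;
  last first.
  by move=> s /andP[_ /negPf s2]; rewrite coefXn eq_sym s2.
apply: eq_big => [s|s /and3P[_ _ /eqP->]]; last by rewrite coefXn.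
case: (boolP (avoids231 s)) => //= /maxdrop_le_des le_md.
case: eqP => [s2|_]; last by rewrite andbF.
by rewrite andbT (leq_trans le_md) ?s2.
Qed.
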